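(* Let $\mathcal{U}=\sum_{l=1}^{r}\sigma_{l}\,\mathcal{U}^{(l)}$ be a rank-$r$ canonical tensor and let $G$ be the $r\times r$ Gram matrix with entries $G_{ll'}=\langle\sigma_l\,\mathcal{U}^{(l)},\sigma_{l'}\,\mathcal{U}^{(l')}\rangle$. Let a symmetric interpolative decomposition of $G$ with skeleton indices $l_1,\dots,l_k$ be given by $$G_{k}=P^{*}G_{s}P,\qquad \left\Vert G-G_{k}\right\Vert _{2}\leq\epsilon_{k},$$ where $G_{s}$ is the $k\times k$ submatrix of $G$ with rows and columns indexed by $l_1,\dots,l_k$, and $P$ is the $k\times r$ coefficient matrix. Then the corresponding tensor interpolative decomposition $$\mathcal{U}_k=\sum_{m=1}^k\Big(\sigma_{l_m}\sum_{l=1}^rP_{ml}\Big)\,\mathcal{U}^{(l_m)}$$ of $\mathcal{U}$ satisfies $$\left\Vert \mathcal{U}-\mathcal{U}_{k}\right\Vert _{F}\leq r\sqrt{\epsilon_{k}}.$$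
   Context: A rank-$r$ canonical tensor (CTD) is $\mathcal{U}=\sum_{l=1}^r\sigma_l\,\mathcal{U}^{(l)}\in\bigotimes_{j=1}^d\mathbb{R}^{M_j}$ with $\sigma_l>0$ and $\mathcal{U}^{(l)}=\bigotimes_{j=1}^d\mathbf{u}_j^{(l)}$, $\mathbf{u}_j^{(l)}\in\mathbb{R}^{M_j}$, $\|\mathbf{u}_j^{(l)}\|=1$. $\langle\cdot,\cdot\rangle$ is the Frobenius (entrywise Euclidean) inner product of tensors and $\|\cdot\|_F$ its norm; $\|\cdot\|_2$ is the matrix spectral norm. A symmetric interpolative decomposition of the Gram matrix $G$ with distinct skeleton indices $l_1,\dots,l_k\in\{1,\dots,r\}$ is $G_k=P^*G_sP$ in which the columns of $P$ with indices $l_1,\dots,l_k$ form the $k\times k$ identity matrix, and $P$ solves the normal equations $G_sP=G_{\mathcal{L}}$, where $G_{\mathcal{L}}$ is the $k\times r$ matrix formed by the rows of $G$ with indices $l_1,\dots,l_k$. (Equivalently, writing $U$ for the matrix with columns $\sigma_l\,\mathcal{U}^{(l)}$ and $U_c$ for its submatrix of skeleton columns, $U_c^*U_cP=U_c^*U$.) *)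

(* Defs.v *)
From HB Require Import structures.
From mathcomp Require Import all_boot all_order all_algebra.
From mathcomp Require Import classical_sets reals.

Set Implicit Arguments.
Unset Strict Implicit.
Unset Printing Implicit Defensive.

Import Order.TTheory GRing.Theory Num.Theory.
Local Open Scope classical_set_scope.
Local Open Scope ring_scope.

Definition vnorm (R : realType) n (x : 'cV[R]_n) : R :=
  Num.sqrt (\sum_i x i 0 ^+ 2).

(* The operator norm induced by [vnorm]. The set is nonempty (it contains 0)
   and bounded, so the junk value of [sup] is never taken; using the closed
   unit ball rather than the sphere also covers n = 0. *)
Definition spectral_norm (R : realType) m n (A : 'M[R]_(m, n)) : R :=
  sup [set vnorm (A *m x) | x in [set x : 'cV[R]_n | vnorm x <= 1]].

(* The tensor product of the R^(M j), j < d: real arrays indexed by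
   multi-indices. [R^o] provides the vector space structure. *)
Definition tensor (R : realType) d (M : 'I_d -> nat) :=
  {ffun {dffun forall j : 'I_d, 'I_(M j)} -> R^o}.

Definition tdot (R : realType) d (M : 'I_d -> nat) (A B : tensor R M) : R :=
  \sum_i A i * B i.

Definition frobenius_norm (R : realType) d (M : 'I_d -> nat)
    (A : tensor R M) : R :=
  Num.sqrt (tdot A A).

Definition tprod (R : realType) d (M : 'I_d -> nat)
    (u : forall j, 'cV[R]_(M j)) : tensor R M :=
  [ffun i : {dffun forall j : 'I_d, 'I_(M j)} => \prod_j u j (i j) 0].

(* [r] is the number of terms of the representation (the separation rank); it
   is not required to be minimal. *)
Record ctd (R : realType) d (M : 'I_d -> nat) (r : nat) := CTD {
  ctd_sigma : 'I_r -> R;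
  ctd_factor : 'I_r -> forall j, 'cV[R]_(M j);
  ctd_sigma_gt0 : forall l, 0 < ctd_sigma l;
  ctd_factor_norm : forall l j, vnorm (ctd_factor l j) = 1 }.

Section CTD.
Variables (R : realType) (d : nat) (M : 'I_d -> nat) (r : nat).
Variable U : ctd R M r.

Definition ctd_term (l : 'I_r) : tensor R M := tprod (ctd_factor U l).

Definition ctd_tensor : tensor R M := \sum_l ctd_sigma U l *: ctd_term l.

Definition gram : 'M[R]_r :=
  \matrix_(l, l') tdot (ctd_sigma U l *: ctd_term l)
                       (ctd_sigma U l' *: ctd_term l').

Definition tensor_id k (s : 'I_k -> 'I_r) (P : 'M[R]_(k, r)) : tensor R M :=
  \sum_m (ctd_sigma U (s m) * \sum_l P m l) *: ctd_term (s m).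

End CTD.

(* [s] lists the skeleton indices. The conjunct on [colsub s P] says that the
   skeleton columns of [P] form the identity; the next one is the normal
   equations. The adjoint is the transpose since everything is real. *)
Definition symmetric_id (R : realType) r k (G : 'M[R]_r) (s : 'I_k -> 'I_r)
    (P : 'M[R]_(k, r)) (Gk : 'M[R]_r) : Prop :=
  [/\ injective s,
      colsub s P = 1%:M,
      mxsub s s G *m P = rowsub s G
    & Gk = P^T *m mxsub s s G *m P].

(* Main.v *)
Require Import Defs.
From mathcomp Require Import all_boot all_order all_algebra.
From mathcomp Require Import classical_sets reals.
From mathcomp Require Import lra.
Local Open Scope ring_scope.

(** The normal equations say that the residual
    [D_l = a_l - \sum_m P_ml a_(s m)] of the term [a_l = sigma_l U^(l)] is
    orthogonal to every skeleton term, whence [|D_l|^2 = <a_l, D_l>], which is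
    the diagonal entry [(G - Gk)_ll] and so at most [||G - Gk||_2]. As the error
    of the tensor decomposition is [\sum_l D_l], the inequality
    [(\sum_l x_l)^2 <= r \sum_l x_l^2] bounds its square by [r * (r * eps)]. *)

Set Implicit Arguments.
Unset Strict Implicit.
Unset Printing Implicit Defensive.

Import Order.TTheory GRing.Theory Num.Theory.

(** Expanding both sides over pairs [(l, l')] reduces the claim to
    [x l * x l' <= (x l ^+ 2 + x l' ^+ 2) / 2]. *)
Lemma sqr_sum_le (R : realFieldType) r (x : 'I_r -> R) :
  (\sum_l x l) ^+ 2 <= r%:R * \sum_l x l ^+ 2.
Proof.
have const_sum (c : R) : \sum_(l < r) c = r%:R * c.
  by rewrite sumr_const card_ord mulr_natl.
have -> : r%:R * \sum_l x l ^+ 2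
    = \sum_l \sum_l' (x l ^+ 2 + x l' ^+ 2) / 2.
  under [RHS]eq_bigr => l _ do rewrite -mulr_suml big_split /= const_sum.
  rewrite -mulr_suml big_split /= const_sum -mulr_sumr.
  lra.
rewrite expr2 mulr_suml; apply: ler_sum => l _.
rewrite mulr_sumr; apply: ler_sum => l' _.
have := sqr_ge0 (x l - x l'); lra.
Qed.

Section VectorNorm.
Variable R : realType.

Lemma sqr_sum_ge0 n (x : 'cV[R]_n) : 0 <= \sum_i x i 0 ^+ 2.
Proof. by apply: sumr_ge0 => i _; exact: sqr_ge0. Qed.

Lemma normr_le_vnorm n (x : 'cV[R]_n) i : `|x i 0| <= vnorm x.
Proof.
rewrite -sqrtr_sqr ler_sqrt ?sqr_sum_ge0// (bigD1 i)//= lerDl.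
by apply: sumr_ge0 => j _; exact: sqr_ge0.
Qed.

Lemma vnorm_delta n (i : 'I_n) : vnorm (delta_mx i 0 : 'cV[R]_n) = 1.
Proof.
rewrite /vnorm (bigD1 i)//= mxE !eqxx expr1n big1 ?addr0 ?sqrtr1// => j ji.
by rewrite mxE (negbTE ji) expr0n.
Qed.

Lemma vnorm_mulmx_le_spectral_norm m n (A : 'M[R]_(m, n)) (x : 'cV[R]_n) :
  vnorm x <= 1 -> vnorm (A *m x) <= spectral_norm A.
Proof.
move=> x1; apply: ub_le_sup; last by exists x.
(* A vector of the closed unit ball has entries of absolute value at most 1, so coordinate [i] of
   its image is bounded by the absolute sum of row [i]. *)
exists (Num.sqrt (\sum_i (\sum_j `|A i j|) ^+ 2)) => _ [y /= y1 <-].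
rewrite /vnorm ler_sqrt; last by apply: sumr_ge0 => i _; exact: sqr_ge0.
apply: ler_sum => i _; rewrite mxE -real_normK ?num_real//.
apply: lerXn2r; rewrite ?nnegrE ?sumr_ge0//.
apply: le_trans (ler_norm_sum _ _ _) _; apply: ler_sum => j _.
rewrite normrM ler_piMr//; exact: le_trans (normr_le_vnorm y j) y1.
Qed.

(** The entry is coordinate [i] of the image of the [j]-th basis vector, which has norm 1. *)
Lemma normr_le_spectral_norm m n (A : 'M[R]_(m, n)) i j :
  `|A i j| <= spectral_norm A.
Proof.
have <- : (A *m (delta_mx j 0 : 'cV_n)) i 0 = A i j by rewrite -colE mxE.
apply: le_trans (normr_le_vnorm _ _) _.
by apply: vnorm_mulmx_le_spectral_norm; rewrite vnorm_delta.
Qed.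

End VectorNorm.

Section TensorDot.
Variables (R : realType) (d : nat) (M : 'I_d -> nat).
Implicit Types A B C : tensor R M.

Lemma tdotC A B : tdot A B = tdot B A.
Proof. by apply: eq_bigr => i _; rewrite mulrC. Qed.

Lemma tdotBr A B C : tdot A (B - C) = tdot A B - tdot A C.
Proof. by rewrite -sumrB; apply: eq_bigr => i _; rewrite !ffunE mulrBr. Qed.

Lemma tdot_sumr k A (c : 'I_k -> R) (B : 'I_k -> tensor R M) :
  tdot A (\sum_m c m *: B m) = \sum_m c m * tdot A (B m).
Proof.
under [RHS]eq_bigr => m _ do rewrite mulr_sumr.
rewrite exchange_big/=; apply: eq_bigr => i _.
rewrite sum_ffunE mulr_sumr; apply: eq_bigr => m _.
by rewrite ffunE mulrCA.
Qed.

(** This is [sqr_sum_le] applied at each multi-index, then summed. *)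
Lemma tdot_sum_le r (D : 'I_r -> tensor R M) :
  tdot (\sum_l D l) (\sum_l D l) <= r%:R * \sum_l tdot (D l) (D l).
Proof.
rewrite exchange_big/= mulr_sumr; apply: ler_sum => i _.
by rewrite sum_ffunE; exact: sqr_sum_le.
Qed.

End TensorDot.

Section Residual.
Variables (R : realType) (d : nat) (M : 'I_d -> nat) (r : nat).
Variables (U : ctd R M r) (k : nat) (s : 'I_k -> 'I_r) (P : 'M[R]_(k, r)).

Definition scaled_term (l : 'I_r) : tensor R M := ctd_sigma U l *: ctd_term U l.

Definition residual (l : 'I_r) : tensor R M :=
  scaled_term l - \sum_m P m l *: scaled_term (s m).

(** Exchanging the sums over [l] and [m] gathers, for each skeleton term, the row sum of [P] that is
    its coefficient in [tensor_id]. *)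
Lemma tensor_id_error : ctd_tensor U - tensor_id U s P = \sum_l residual l.
Proof.
rewrite sumrB exchange_big/=; congr (_ - _); apply: eq_bigr => m _.
by rewrite -scaler_suml scalerA mulrC.
Qed.

Lemma tdot_residual l Gk :
  symmetric_id (gram U) s P Gk ->
  tdot (residual l) (residual l) = (gram U - Gk) l l.
Proof.
case=> _ _ normal ->.
have normalE m :
    \sum_m' gram U (s m) (s m') * P m' l = gram U (s m) l.
  have /matrixP/(_ m l) := normal; rewrite !mxE => <-.
  by apply: eq_bigr => m' _; rewrite !mxE.
have ortho m : tdot (residual l) (scaled_term (s m)) = 0.
  rewrite tdotC tdotBr tdot_sumr.
  have := normalE m; rewrite mxE => <-; apply/eqP; rewrite subr_eq0; apply/eqP.
  by apply: eq_bigr => m' _; rewrite mxE mulrC.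
(* Only the second argument is expanded: orthogonality then removes its whole skeleton part. *)
rewrite {2}/residual tdotBr tdot_sumr big1 => [|m _]; last first.
  by rewrite ortho mulr0.
(* The normal equations turn [Gk] into [P^T *m rowsub s (gram U)], whose diagonal entry is the sum
   subtracted on the left, up to symmetry of [tdot]. *)
rewrite subr0 tdotC tdotBr tdot_sumr -mulmxA normal !mxE.
congr (_ - _); apply: eq_bigr => m _.
by rewrite !mxE tdotC.
Qed.

End Residual.

Theorem theorem3p5 (R : realType) (d : nat) (M : 'I_d -> nat) (r : nat)
    (U : ctd R M r) (k : nat) (s : 'I_k -> 'I_r) (P : 'M[R]_(k, r))
    (Gk : 'M[R]_r) (eps : R) :
  symmetric_id (gram U) s P Gk ->
  spectral_norm (gram U - Gk) <= eps ->
  frobenius_norm (ctd_tensor U - tensor_id U s P) <= r%:R * Num.sqrt eps.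
Proof.
move=> symid le_eps.
have le_res l : tdot (residual U s P l) (residual U s P l) <= eps.
  rewrite (tdot_residual l symid); apply: le_trans (ler_norm _) _.
  exact: le_trans (normr_le_spectral_norm _ l l) le_eps.
(* The bound becomes [Num.sqrt (r%:R ^+ 2 * eps)], so that the radicands can be compared. One factor
   [r] comes from [tdot_sum_le], the other from summing [r] residual bounds. *)
rewrite -[r%:R]ger0_norm// -sqrtr_sqr -sqrtrM ?sqr_ge0//.
rewrite /frobenius_norm tensor_id_error; apply: ler_wsqrtr.
apply: le_trans (tdot_sum_le _) _.
rewrite expr2 -mulrA ler_wpM2l//.
apply: le_trans (ler_sum _ (fun l _ => le_res l)) _.
by rewrite sumr_const card_ord mulr_natl.
Qed.
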